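(* For any integer $r\geq 2$, we have \[\log (r+1)\leq rM(r)\leq \log r+\log\log r +\log c_1,\] where $c_1=41.30142$.
   Context: For a positive integer $n$, $M(n):=\frac{1}{\varphi(n)}\sum_{1\leq\ell\leq n,\ \gcd(\ell,n)=1}\frac{1}{\ell}$, where $\varphi$ denotes the Euler totient function. $\log$ is the natural logarithm. *)

(* Defs.v *)
From mathcomp Require Import all_boot all_order all_algebra.
From mathcomp Require Import all_classical all_reals all_analysis.

Set Implicit Arguments.
Unset Strict Implicit.
Unset Printing Implicit Defensive.

Import Order.TTheory GRing.Theory Num.Theory.

Local Open Scope ring_scope.

Definition M (R : realType) (n : nat) : R :=
  (totient n)%:R^-1 * \sum_(1 <= l < n.+1 | coprime l n) l%:R^-1.

(* The decimal 41.30142, split because a literal as large as 4130142 would be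
   expanded in unary. *)
Definition c1 (R : realType) : R := 41 + 301 / 10 ^+ 3 + 42 / 10 ^+ 5.

(* Main.v *)
Require Import Defs.
From mathcomp Require Import all_boot all_order all_algebra.
From mathcomp Require Import all_classical all_reals all_analysis.
From mathcomp Require Import ring lra.

Import numFieldNormedType.Exports.
Import Order.TTheory GRing.Theory Num.Theory.

Local Open Scope ring_scope.

(** Let [P] be the set of primes dividing [r], let [S] be the sum of the [1/l]
    over the [l <= r] divisible by no prime of [P], and let
    [V = \prod_(p in P) (1 - 1/p)].  Since [totient r = r * V], the quantity to
    bound is [r * M r = S / V].

    Sieve one prime at a time.  Removing the multiples of a prime [p] from a
    sifted sum over [l <= x] subtracts [1/p] times the same sifted sum over
    [l <= x / p] ([sifted_harmonic_cons]).  The shorter sum is at most the longer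
    one, so every step multiplies the sum by at least [1 - 1/p]; hence
    [S >= V * H_r >= V * ln (r + 1)], which is the lower bound.

    For the upper bound, [H_x] is [ln x + e + O(1/x)] for a constant [e], and the
    expression [V * (ln x + \sum_(p in P) ln p / (p - 1) + e)] obeys the same
    recursion as the sifted sum, so the bound on the error doubles at each
    prime ([sieve_error]).  As all integers [x] that occur are divisors of [r],
    there is no rounding, and the final error, relative to [V], is at most
    [2 ^ #|P| / (4 * totient r) <= 1/2].  With [e <= 1] this gives
    [r * M r <= ln r + \sum_(p in P) ln p / (p - 1) + 3/2].

    It remains to see that [\sum_(p in P) ln p / (p - 1) <= ln (ln r) + 2].
    Split [1 / (p - 1) = 1/p + 1 / (p * (p - 1))].  The second part is at most
    [3/2], even when extended to all integers [p >= 2], by telescoping.  For the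
    first part, [ln n`! >= \sum_(p in P) (n %/ p) * ln p], and
    [n %/ p >= (n + 1) / p - 1] with [\sum_(p in P) ln p <= ln r] give
    [\sum_(p in P) ln p / p <= (ln n`! + ln r) / (n + 1)] for every [n].  The
    value of [n] to take is the integer part of [ln r], which makes this at most
    [ln (ln r) + 1/2] ([log_weight_primes_le_lnln]).

    The constants add up to [7/2], which is below [ln c1] because
    [(10/9)^35 <= 41].  The case [r = 2], where [ln r < 1], is computed directly. *)

(** * Products of distinct primes and sums over multiples *)

Lemma prod_dvdn_of_primes (s : seq nat) m :
  uniq s -> all prime s -> all (dvdn^~ m) s -> (\prod_(p <- s) p %| m)%N.
Proof.
elim: s => [|p s IH] /=; first by rewrite big_nil dvd1n.
move=> /andP[ps us] /andP[pp pr] /andP[pm sm].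
rewrite big_cons Gauss_dvd ?pm ?IH // big_seq.
apply: (big_ind (coprime p)) => [|a b ca cb|q qs]; first exact: coprimen1.
  by rewrite coprimeMr ca.
rewrite prime_coprime // dvdn_prime2 ?(allP pr _ qs) //.
by apply: contraNN ps => /eqP ->.
Qed.

(** The substitution [l = p * m]; the condition [Q] allows for further sieving. *)
Lemma sum_over_multiples (V : nmodType) p (Q : pred nat) (f : nat -> V) n :
    (0 < p)%N ->
  \sum_(1 <= l < n.+1 | (p %| l)%N && Q l) f l =
  \sum_(1 <= m < (n %/ p).+1 | Q (p * m)%N) f (p * m)%N.
Proof.
move=> p0; elim: n => [|n IH]; first by rewrite div0n !big_geq.
rewrite big_mkcond big_nat_recr //= -big_mkcond IH divnS //=.
have [/dvdnP[k nk]|_] := boolP (p %| n.+1)%N; last by rewrite addr0.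
have kE : k = (n %/ p).+1.
  by have := divnS n p0; rewrite {1}nk mulnK // nk dvdn_mull.
rewrite add1n [RHS]big_mkcond [RHS]big_nat_recr //= -big_mkcond.
by rewrite nk kE [(_.+1 * p)%N]mulnC.
Qed.

Lemma prod_primes_gt0 (s : seq nat) : all prime s -> (0 < \prod_(p <- s) p)%N.
Proof.
elim: s => [|p s IH] /=; first by rewrite big_nil.
by move=> /andP[/prime_gt0 p0 ps]; rewrite big_cons muln_gt0 p0 IH.
Qed.

(** * Primes dividing an integer *)

Definition sifted (P : seq nat) := [pred l | all (fun p => ~~ (p %| l)%N) P].

Lemma sifted_primes r l : (0 < r)%N -> (0 < l)%N -> sifted (primes r) l = coprime l r.
Proof.
move=> r0 l0; rewrite coprime_has_primes // -all_predC.
by apply: eq_in_all => p /=; rewrite !mem_primes l0 => /andP[-> _].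
Qed.

(** Each factor [p.-1] is at least 2, except for a possible single [p = 2];
    the factor [(2 \in P).+1] pays for that one. *)
Lemma pow2_size_le (P : seq nat) : uniq P -> all prime P ->
  (2 ^ size P <= (2 \in P).+1 * \prod_(p <- P) p.-1)%N.
Proof.
elim: P => [|p P IH] /=; first by rewrite big_nil.
move=> /andP[pP uP] /andP[pp prP]; rewrite big_cons inE expnS.
have {}IH := IH uP prP; have [p2|p2] := eqVneq 2%N p.
  by move: IH; rewrite -p2 in pP *; rewrite (negbTE pP) /= !mul1n leq_pmul2l.
rewrite /= mulnCA leq_mul //.
by have := prime_gt1 pp; case: p p2 {pP pp} => [|[|[|p]]].
Qed.

Lemma primes_prime r : all prime (primes r).
Proof. by apply/allP => p; rewrite mem_primes => /andP[]. Qed.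

Lemma pow2_size_primes_le r : (0 < r)%N -> (2 ^ size (primes r) <= 2 * totient r)%N.
Proof.
move=> r0; apply: leq_trans (pow2_size_le _ (primes_uniq r) (primes_prime r)) _.
apply: leq_mul; first by case: (2%N \in _).
rewrite totientE // big_seq [leqRHS]big_seq; apply: leq_prod => p pr.
have pp : prime p by move: pr; rewrite mem_primes => /andP[].
by rewrite leq_pmulr // expn_gt0 prime_gt0.
Qed.

(** * Inequalities for the logarithm *)

Lemma ln_le_sub1 (R : realType) (t : R) : 0 < t -> ln t <= t - 1.
Proof.
by move=> t0; have := @le_ln1Dx R (t - 1); rewrite [1 + _]addrC subrK; apply; lra.
Qed.

Lemma ln_ge_1subV (R : realType) (t : R) : 0 < t -> 1 - t^-1 <= ln t.
Proof.
move=> t0; have := @ln_le_sub1 R t^-1; rewrite invr_gt0 => /(_ t0).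
by rewrite lnV ?posrE //; lra.
Qed.

(** The trapezoidal bound: the integral of the convex function [1/x] over [[1, t]]
    is at most that of its chord.  It is proved by differentiating
    [s - 1/s - 2 * ln s], whose derivative is the square [(1 - 1/s)^2]. *)
Lemma ln_le_half_subV (R : realType) (t : R) : 1 <= t -> ln t <= (t - t^-1) / 2.
Proof.
move=> t1; pose f (s : R) := s - s^-1 - 2 * ln s.
have df (s : R) : 0 < s -> is_derive s 1 f ((1 - s^-1) ^+ 2).
  move=> s0; have s0' : s != 0 by rewrite gt_eqF.
  have dl := is_derive1_ln s0.
  have di := @is_deriveV R (@id R) s 1 1 s0' (is_derive_id s 1).
  have := is_deriveB (is_deriveB (is_derive_id s 1) di) (is_deriveZ 2 dl).
  move=> h; apply: (is_derive_eq h); rewrite /GRing.scale /=.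
  by field.
have fin : {in `]1, t[, forall s, derivable f s 1}.
  by move=> s; rewrite in_itv /= => /andP[s1 _]; apply: ex_derive; apply: df; lra.
have := @ger0_derive1_le_cc R f 1 t fin.
suff H : (forall x : R, x \in `]1, t[ -> 0 <= f^`()%classic x) /\
   {within `[1, t], continuous f}%classic.
  move=> /(_ H.1 H.2 1 t); rewrite !in_itv /= !lexx t1 /= => /(_ isT isT isT).
  by rewrite /f ln1 invr1; lra.
split=> [s|].
  rewrite in_itv /= => /andP[s1 _]; rewrite derive1E.
  by rewrite (derive_val (is_derive := df s _)) ?sqr_ge0 //; lra.
apply: derivable_within_continuous => s; rewrite in_itv /= => /andP[s1 _].
by apply: ex_derive; apply: df; lra.
Qed.

(** * Harmonic sums and sums of logarithms *)

Section HarmonicSums.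
Variable R : realType.

Definition harmonic_sum (x : nat) : R := \sum_(1 <= l < x.+1) l%:R^-1.

Lemma ln_succ_ge n : (0 < n)%N -> (n.+1%:R : R)^-1 <= ln n.+1%:R - ln n%:R.
Proof.
move=> n0; have n0R : (0 : R) < n%:R by rewrite ltr0n.
rewrite -ln_div ?posrE ?ltr0n // -natr1.
apply: le_trans (@ln_ge_1subV _ _ _); last by apply: divr_gt0; lra.
by rewrite le_eqVlt; apply/orP; left; apply/eqP; field; lra.
Qed.

Lemma ln_succ_le n : (0 < n)%N -> ln n.+1%:R - ln n%:R <= (n%:R : R)^-1.
Proof.
move=> n0; have n0R : (0 : R) < n%:R by rewrite ltr0n.
rewrite -ln_div ?posrE ?ltr0n // -natr1.
apply: le_trans (@ln_le_sub1 _ _ _) _; first by apply: divr_gt0; lra.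
by rewrite le_eqVlt; apply/orP; left; apply/eqP; field; lra.
Qed.

Lemma ln_succ_trapezoid n : (0 < n)%N ->
  ln n.+1%:R - ln n%:R <= ((n%:R : R)^-1 + n.+1%:R^-1) / 2.
Proof.
move=> n0; have n0R : (0 : R) < n%:R by rewrite ltr0n.
rewrite -ln_div ?posrE ?ltr0n // -natr1.
apply: le_trans (@ln_le_half_subV _ _ _) _.
  by rewrite ler_pdivlMr //; lra.
by rewrite le_eqVlt; apply/orP; left; apply/eqP; field; lra.
Qed.

Lemma harmonic_sumS n : harmonic_sum n.+1 = harmonic_sum n + n.+1%:R^-1.
Proof. by rewrite /harmonic_sum big_nat_recr. Qed.

Lemma harmonic_sum1 : harmonic_sum 1 = 1.
Proof. by rewrite /harmonic_sum big_nat1 invr1. Qed.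

Lemma ln_succ_le_harmonic n : (0 < n)%N -> ln n.+1%:R <= harmonic_sum n.
Proof.
case: n => // n _; elim: n => [|n IH].
  by rewrite harmonic_sum1 (le_trans (@ln_le_sub1 R 2 _)) //; lra.
rewrite harmonic_sumS -(subrK (ln n.+2%:R) (ln n.+3%:R)) addrC.
by rewrite lerD ?ln_succ_le.
Qed.

Lemma harmonic_sub_ln_le1 n : (0 < n)%N -> harmonic_sum n - ln n%:R <= 1.
Proof.
case: n => // n _; elim: n => [|n IH].
  by rewrite harmonic_sum1 ln1; lra.
rewrite harmonic_sumS; have := @ln_succ_ge n.+1 isT; move: IH.
move: (_^-1) (ln _) (ln _) => a b c; lra.
Qed.

(** The sequence [H_n - ln n] decreases, while [H_n - ln n - 1/(2n)] increases by
    the trapezoidal bound.  Comparing it at two finite places avoids its limit, the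
    Euler constant. *)
Lemma harmonic_sub_ln_decr x k : (0 < x)%N ->
  0 <= (harmonic_sum x - ln x%:R) - (harmonic_sum (x + k) - ln (x + k)%:R)
    <= (2 * x%:R)^-1 - (2 * (x + k)%:R)^-1.
Proof.
move=> x0; elim: k => [|k /andP[lo hi]]; first by rewrite addn0 !subrr lexx.
rewrite addnS harmonic_sumS.
have xk0 : (0 < x + k)%N by rewrite addn_gt0 x0.
have t1 := ln_succ_trapezoid _ xk0; have t2 := ln_succ_ge _ xk0.
move: lo hi t1 t2; rewrite !invfM.
have alg (d h a b u v w : R) : 0 <= d - (h - a) -> d - (h - a) <= 2^-1 * u - 2^-1 * v ->
    b - a <= (v + w) / 2 -> w <= b - a ->
  0 <= d - (h + w - b) <= 2^-1 * u - 2^-1 * w.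
  by move=> *; apply/andP; split; lra.
exact: alg.
Qed.

(** Numerical lower bounds for logarithms come from [ln (10/9) >= 1/10]: it is
    enough to fit a power of [10/9] under [x]. *)
Lemma ln_ge_of_pow k (x : R) : 0 < x -> (10 / 9) ^+ k <= x -> k%:R / 10 <= ln x.
Proof.
move=> x0 le; have le2 : ln ((10 / 9 : R) ^+ k) <= ln x.
  by rewrite ler_ln ?posrE //; apply: exprn_gt0; lra.
apply: le_trans le2; rewrite lnXn; last by lra.
have : 1 - (10/9 : R)^-1 <= ln (10/9) by apply: ln_ge_1subV; lra.
rewrite invf_div => h; rewrite -[leRHS]mulr_natl.
apply: ler_wpM2l => //; lra.
Qed.

Lemma ln_c1_ge : 7 / 2 <= ln (c1 R).
Proof.
have c41 : 41 <= c1 R by rewrite /c1; lra.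
have := @ln_ge_of_pow 35 (c1 R); have -> : 35%:R / 10 = 7 / 2 :> R by field.
apply; [lra|apply: le_trans c41; lra].
Qed.

Lemma ln3_ge1 : 1 <= ln (3 : R).
Proof.
have := @ln_ge_of_pow 10 3; rewrite divff //; apply; lra.
Qed.

Lemma ln2_ge : 1/2 <= ln (2 : R).
Proof. have := @ln_ge_of_pow 5 2 => h; have := h _ _; lra. Qed.

Lemma sum_ln_le n : (0 < n)%N ->
  \sum_(1 <= m < n.+1) ln (m%:R : R) <= n.+1%:R * ln n%:R - n%:R + 1.
Proof.
case: n => // n _; elim: n => [|n IH].
  by rewrite big_nat1 ln1; lra.
rewrite big_nat_recr //=.
have := @ln_succ_ge n.+1 isT; rewrite -(ler_pM2l (_ : (0 : R) < n.+2%:R)) //.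
rewrite divff // => h.
have e2 : (n.+2%:R : R) = n.+1%:R + 1 by rewrite natr1.
have e3 : (n.+3%:R : R) = n.+1%:R + 2 by rewrite -addn2 natrD.
rewrite e3; rewrite e2 in IH h *; lra.
Qed.

(** Telescoping: [(ln x + 3/2) / x] is nearly a primitive of [- ln x / x^2], and
    for [m >= 3] its decrease from [m - 1] to [m] covers the term of index [m],
    because [m * ln (m / (m - 1)) <= m / (m - 1) <= 3/2]. *)
Lemma sum_ln_quadratic_le n : (1 < n)%N ->
  \sum_(2 <= m < n.+1) ln (m%:R : R) / (m%:R * (m%:R - 1))
    <= 3/2 - (ln n%:R + 3/2) / n%:R.
Proof.
case: n => // -[//|n] _; elim: n => [|n IH].
  rewrite big_nat1 (_ : 2 * (2 - 1) = 2 :> R); last by ring.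
  by have := @ln_le_half_subV R 2 (ler1n _ 2); lra.
rewrite big_nat_recr //=; apply: le_trans (lerD IH (lexx _)) _.
have := @ln_succ_le n.+2 isT.
have e3 : (n.+3%:R : R) = n.+2%:R + 1 by rewrite natr1.
have e2 : (2 : R) <= n.+2%:R by rewrite ler_nat.
rewrite e3; set u := ln _; set v := ln _; set a := n.+2%:R in e2 *.
move=> h; rewrite -subr_ge0.
suff -> : 3 / 2 - (u + 3 / 2) / (a + 1)
   - (3 / 2 - (v + 3 / 2) / a + u / ((a + 1) * (a + 1 - 1)))
   = (3/2 - (a + 1) * (u - v)) / (a * (a + 1)).
  apply: divr_ge0; last by apply: mulr_ge0; lra.
  have /(ler_wpM2l (_ : 0 <= a + 1)) : u - v <= a^-1 := h.
  move=> /(_ ltac:(lra)) h2; rewrite subr_ge0; apply: le_trans h2 _.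
  by rewrite ler_pdivrMr; lra.
field; lra.
Qed.
End HarmonicSums.

(** * Sieving the harmonic sum *)

Section Sieve.
Variable R : realType.
Implicit Types (P : seq nat) (x : nat).

Definition sifted_harmonic P x : R :=
  \sum_(1 <= l < x.+1 | sifted P l) l%:R^-1.

Definition sieve_density P : R := \prod_(p <- P) (1 - p%:R^-1).

(** Minus the logarithmic derivative at [s = 1] of the Euler product
    [\prod_(p <- P) (1 - p^-s)^-1]: the secondary term of the sieved harmonic sum. *)
Definition log_weight P : R := \sum_(p <- P) ln p%:R / (p%:R - 1).

Lemma sifted_harmonic_le P x y : (x <= y)%N ->
  sifted_harmonic P x <= sifted_harmonic P y.
Proof.
move=> xy; rewrite /sifted_harmonic [leRHS](big_cat_nat (n := x.+1)) //=.
by rewrite lerDl; apply: sumr_ge0 => l _; rewrite invr_ge0.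
Qed.

Lemma sifted_harmonic_nil x : sifted_harmonic [::] x = harmonic_sum R x.
Proof. by []. Qed.

(** Among the integers that survive [P], the multiples of [p] are the [p * m] with
    [m] surviving [P], because no prime of [P] divides [p]. *)
Lemma sifted_harmonic_cons p P x :
    prime p -> p \notin P -> all prime P ->
  sifted_harmonic (p :: P) x =
  sifted_harmonic P x - p%:R^-1 * sifted_harmonic P (x %/ p).
Proof.
move=> pp pP prP; apply/eqP; rewrite eq_sym subr_eq; apply/eqP.
rewrite /sifted_harmonic [LHS](bigID (fun l => p %| l)%N) /= addrC.
congr (_ + _); first by apply: eq_bigl => l; rewrite andbC.
under eq_bigl do rewrite andbC.
rewrite sum_over_multiples ?prime_gt0 // mulr_sumr.
apply: eq_big => [l|l _]; last by rewrite natrM invfM.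
apply: eq_in_all => q qP; have prq := allP prP _ qP.
rewrite Euclid_dvdM // dvdn_prime2 // (_ : (q == p) = false) //.
by apply: contraNF pP => /eqP <-.
Qed.

Lemma prime_inv_lt1 {p} : prime p -> (0 : R) < 1 - p%:R^-1.
Proof.
move=> pp; rewrite subr_gt0 invf_lt1 ?ltr0n ?prime_gt0 //.
by rewrite ltr1n prime_gt1.
Qed.

Lemma sieve_density_gt0 P : all prime P -> 0 < sieve_density P.
Proof.
move=> /allP pr; rewrite /sieve_density big_seq.
by apply: prodr_gt0 => p /pr; exact: prime_inv_lt1.
Qed.

Lemma density_harmonic_le P x : uniq P -> all prime P ->
  sieve_density P * harmonic_sum R x <= sifted_harmonic P x.
Proof.
elim: P => [|p P IH] /=.
  by rewrite /sieve_density big_nil mul1r sifted_harmonic_nil.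
move=> /andP[pP uP] /andP[pp prP]; rewrite sifted_harmonic_cons //.
have {}IH := IH uP prP; rewrite /sieve_density big_cons -/(sieve_density P).
have := sifted_harmonic_le P _ _ (leq_div x p).
rewrite -(ler_pM2l (_ : 0 < p%:R^-1)) ?invr_gt0 ?ltr0n ?prime_gt0 // => le1.
have := IH; rewrite -(ler_pM2l (prime_inv_lt1 pp)) => le2.
lra.
Qed.

(** The recursion for the error, with [s], [t] the sifted sums at [x = y * p] and
    [y], [d] and [w] the density and the log weight of the primes already sieved,
    [ly] and [lp] the logarithms of [y] and [p], [c] the constant of the main term
    and [k / (4x)] the recentring. *)
Lemma sieve_error_recursion (s t d w k c p y lp ly : R) : p != 0 -> p - 1 != 0 -> y != 0 ->
  s - p^-1 * t - (1 - p^-1) * d * (ly + lp + (lp / (p - 1) + w) + c) =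
  s - d * (ly + lp + w + c) - k / (4 * (y * p))
  - p^-1 * (t - d * (ly + w + c) - k / (4 * y)).
Proof. by move=> p0 p1 y0; field; apply/and3P; split => //; rewrite pnatr_eq0. Qed.

(** Both the sifted sum and its main term satisfy the recursion of
    [sifted_harmonic_cons], so the error inherits it, and [x / p] being exact makes
    the bound [2 ^ k / (4x)] double at each prime.  The hypothesis places the error
    for [P = [::]] in [[0, 1/(2x)]]; it is recentred at the midpoint [1/(4x)],
    which halves its size, and the midpoint itself disappears with the first prime,
    since [1/x - p^-1 * (1/(x/p)) = 0]. *)
Lemma sieve_error (e : R) N P :
    (forall x, (0 < x <= N)%N ->
       0 <= harmonic_sum R x - ln x%:R - e <= (2 * x%:R)^-1) ->
    uniq P -> all prime P ->
  forall x, (0 < x <= N)%N -> (\prod_(p <- P) p %| x)%N ->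
  `| sifted_harmonic P x - sieve_density P * (ln x%:R + log_weight P + e)
     - (P == [::])%:R / (4 * x%:R) | <= 2 ^+ size P / (4 * x%:R).
Proof.
move=> hN; elim: P => [_ _ x xN _|p P IH] /=.
  rewrite sifted_harmonic_nil /sieve_density /log_weight !big_nil expr0.
  have x0 : (0 : R) < x%:R by rewrite ltr0n; case/andP: xN.
  have /andP[lo hi] := hN _ xN.
  have two : (2 * x%:R : R)^-1 = 2 * (1 / (4 * x%:R)) by field; lra.
  rewrite two in hi; rewrite ler_norml; apply/andP.
  move: (1 / _) (ln _) (harmonic_sum _) lo hi => a b c lo hi; split; lra.
move=> /andP[pP uP] /andP[pp prP] x /andP[x0 xN] dx.
have {}IH := IH uP prP.
have p0 := prime_gt0 pp; have p1 := prime_gt1 pp.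
have px : (p %| x)%N by apply: dvdn_trans dx; rewrite big_cons dvdn_mulr.
have [y xE] := dvdnP px.
have y0 : (0 < y)%N by move: x0; rewrite xE muln_gt0 => /andP[].
have dy : (\prod_(q <- P) q %| y)%N.
  by move: dx; rewrite xE big_cons mulnC dvdn_pmul2r.
have yx : (y <= x)%N by rewrite xE leq_pmulr.
have /IH/(_ dy) Ey : (0 < y <= N)%N by rewrite y0 (leq_trans yx).
have /IH Ex : (0 < x <= N)%N by rewrite x0.
have {Ex} := Ex _; rewrite {1}xE dvdn_mulr // => /(_ isT) Ex.
rewrite sifted_harmonic_cons // {2}xE mulnK //.
rewrite /sieve_density /log_weight !big_cons -/(sieve_density P).
rewrite -/(log_weight P) mul0r subr0 exprS.
have pR : (1 : R) < p%:R by rewrite ltr1n.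
have yR : (0 : R) < y%:R by rewrite ltr0n.
have xRE : (x%:R : R) = y%:R * p%:R by rewrite xE natrM.
have lnx : ln (x%:R : R) = ln y%:R + ln p%:R by rewrite xRE lnM ?posrE //; lra.
set a := (X in `|X| <= _) in Ex; set b := (X in `|X| <= _) in Ey.
have -> : sifted_harmonic P x - p%:R^-1 * sifted_harmonic P y
   - (1 - p%:R^-1) * sieve_density P
     * (ln x%:R + (ln p%:R / (p%:R - 1) + log_weight P) + e)
   = a - p%:R^-1 * b.
  by clear xE; rewrite /a /b lnx xRE; apply: sieve_error_recursion; lra.
apply: (le_trans (ler_normB _ _)); rewrite normrM [`|p%:R^-1|]ger0_norm; last first.
  by rewrite invr_ge0; lra.
have pi0 : (0 : R) <= p%:R^-1 by rewrite invr_ge0; lra.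
apply: (le_trans (lerD Ex (ler_wpM2l pi0 Ey))).
by clear xE; rewrite xRE le_eqVlt; apply/orP; left; apply/eqP; field; lra.
Qed.

End Sieve.

(** * Bounds over the primes dividing r *)

Section Bounds.
Variable R : realType.

Lemma totient_sieve_density r : (0 < r)%N ->
  (totient r)%:R = r%:R * sieve_density R (primes r).
Proof.
move=> r0; rewrite totientE //.
have := prod_prime_decomp r0; rewrite prime_decompE big_map /= => rE.
rewrite [X in _ = X%:R * _]rE.
rewrite /sieve_density !natr_prod -big_split /=; apply: eq_big_seq => p pr.
have pp : prime p by move: pr; rewrite mem_primes => /andP[].
have := logn_gt0 p r; rewrite pr; case: (logn p r) => // k _ /=.
have p0 : (p%:R : R) != 0 by rewrite pnatr_eq0 -lt0n prime_gt0.
rewrite expnS !natrM -subn1 natrB ?prime_gt0 //.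
by rewrite mulrBr mulr1 mulrAC divff // mul1r mulrBl mul1r.
Qed.

Lemma sum_ln_primes_le (s : seq nat) m : (0 < m)%N ->
    uniq s -> all prime s -> all (dvdn^~ m) s ->
  \sum_(p <- s) ln (p%:R : R) <= ln m%:R.
Proof.
move=> m0 us ps ds.
have pos : (0 < \prod_(p <- s) p)%N by exact: prod_primes_gt0.
have -> : \sum_(p <- s) ln (p%:R : R) = ln (\prod_(p <- s) p)%N%:R.
  elim: s ps {us ds pos} => [|p s IH] /=; first by rewrite !big_nil ln1.
  move=> /andP[pp ps]; rewrite !big_cons natrM lnM ?IH // posrE ltr0n ?prod_primes_gt0 //.
  exact: prime_gt0.
rewrite ler_ln ?posrE ?ltr0n // ler_nat dvdn_leq //.
exact: prod_dvdn_of_primes.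
Qed.

(** The primes of [s] dividing [m] have product at most [m]; summing over
    [m <= n], each [p] is counted [n %/ p] times. *)
Lemma sum_ln_divn_le (s : seq nat) n : uniq s -> all prime s ->
  \sum_(p <- s) ln (p%:R : R) *+ (n %/ p) <= \sum_(1 <= m < n.+1) ln m%:R.
Proof.
move=> us ps.
have -> : \sum_(p <- s) ln (p%:R : R) *+ (n %/ p) =
          \sum_(1 <= m < n.+1) \sum_(p <- s | (p %| m)%N) ln p%:R.
  rewrite (exchange_big_dep xpredT) //= big_seq [RHS]big_seq.
  apply: eq_bigr => p /(allP ps)/prime_gt0 p0.
  rewrite (eq_bigl (fun m => (p %| m)%N && true)) => [|m]; last by rewrite andbT.
  by rewrite (sum_over_multiples R p xpredT) // sumr_const_nat subn1.
rewrite big_nat_cond [leRHS]big_nat_cond; apply: ler_sum => m.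
rewrite andbT => /andP[m0 _]; rewrite -big_filter.
apply: sum_ln_primes_le; rewrite ?filter_uniq //; last exact: filter_all.
by apply/allP => p; rewrite mem_filter => /andP[_ /(allP ps)].
Qed.

(** The rounding loss in [n %/ p >= (n + 1) / p - 1] costs at most one [ln p] for
    each [p], and these add up to at most [ln r].  The inequality is trivially true
    for [p > n], so small and large primes are treated alike. *)
Lemma sum_ln_over_primes_le r n : (0 < r)%N ->
  n.+1%:R * \sum_(p <- primes r) ln (p%:R : R) / p%:R
    <= \sum_(1 <= m < n.+1) ln m%:R + ln r%:R.
Proof.
move=> r0.
apply: le_trans (lerD (sum_ln_divn_le _ n (primes_uniq r) (primes_prime r))
   (sum_ln_primes_le _ _ r0 (primes_uniq r) (primes_prime r) _)); last first.
  by apply/allP => p; rewrite mem_primes => /and3P[].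
rewrite -big_split mulr_sumr big_seq [leRHS]big_seq.
apply: ler_sum => p pr; have /prime_gt0 p0 := allP (primes_prime r) _ pr.
rewrite /= -mulrSr -[leRHS]mulr_natr mulrCA.
apply: ler_wpM2l; first by rewrite ln_ge0 // ler1n.
by rewrite ler_pdivrMr ?ltr0n // -natrM ler_nat ltn_ceil.
Qed.

Lemma sum_ln_quadratic_primes_le r : (1 < r)%N ->
  \sum_(p <- primes r) ln (p%:R : R) / (p%:R * (p%:R - 1)) <= 3/2.
Proof.
move=> r1; have f_ge0 m : (2 <= m)%N -> 0 <= ln (m%:R : R) / (m%:R * (m%:R - 1)).
  move=> m2; have : (2 : R) <= m%:R by rewrite ler_nat.
  move=> m2R; apply: divr_ge0; first by rewrite ln_ge0; lra.
  by apply: mulr_ge0; lra.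
apply: le_trans (le_trans (sum_ln_quadratic_le R r r1) _); last first.
  rewrite gerBl; apply: divr_ge0; last by [].
  by rewrite addr_ge0 ?ln_ge0 ?ler1n ?(ltnW r1) // divr_ge0.
have -> : \sum_(p <- primes r) ln (p%:R : R) / (p%:R * (p%:R - 1)) =
  \sum_(2 <= m < r.+1 | m \in primes r) ln m%:R / (m%:R * (m%:R - 1)).
  rewrite -[RHS]big_filter; apply: perm_big; apply: uniq_perm.
  - exact: primes_uniq.
  - by rewrite filter_uniq // iota_uniq.
  move=> p; rewrite mem_filter mem_index_iota mem_primes.
  have [/and3P[pp r0 pr]|//] := boolP [&& _, _ & _].
  by rewrite prime_gt1 //= ltnS dvdn_leq.
rewrite big_nat_cond [leRHS]big_nat big_mkcondr /=.
by apply: ler_sum => m /andP[m2 _]; case: ifP => // _; exact: f_ge0.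
Qed.

Lemma log_weight_primes_le r n : (1 < r)%N ->
  log_weight R (primes r) <=
    (\sum_(1 <= m < n.+1) ln m%:R + ln r%:R) / n.+1%:R + 3/2.
Proof.
move=> r1.
have -> : log_weight R (primes r) = \sum_(p <- primes r) ln (p%:R : R) / p%:R +
   \sum_(p <- primes r) ln (p%:R : R) / (p%:R * (p%:R - 1)).
  rewrite -big_split; apply: eq_big_seq => p pr /=.
  have /prime_gt1 : prime p := allP (primes_prime r) _ pr.
  rewrite -(ltr1n R) => p1; field; lra.
apply: lerD (sum_ln_quadratic_primes_le r r1).
by rewrite ler_pdivlMr // mulrC sum_ln_over_primes_le // ltnW.
Qed.

(** With [L = ln r], the bound [(ln n`! + L) / (n + 1)] is best for [n] near [L]. *)
Lemma log_weight_primes_le_lnln r : (2 < r)%N ->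
  log_weight R (primes r) <= ln (ln (r%:R : R)) + 2.
Proof.
move=> r2; set L := ln r%:R.
have L1 : 1 <= L.
  by apply: le_trans (ln3_ge1 R) _; rewrite ler_ln ?posrE ?ltr0n ?ler_nat // (ltn_trans _ r2).
have L0 : 0 <= L by lra.
have /andP[nL Ln] := truncn_itv L0.
set n := Num.truncn L in nL Ln.
have n0 : (0 < n)%N by rewrite -ltnS -(ltr1n R); lra.
apply: le_trans (log_weight_primes_le r n (ltnW r2)) _.
rewrite -/L; suff : (\sum_(1 <= m < n.+1) ln m%:R + L) / n.+1%:R <= ln L + 1/2.
  by move=> h; rewrite -lerBrDr (le_trans h) //; lra.
rewrite ler_pdivrMr //.
apply: le_trans (lerD (sum_ln_le R n n0) (lexx L)) _.
have n1R : (1 : R) <= n%:R by rewrite ler1n.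
have nE : (n.+1%:R : R) = n%:R + 1 by rewrite natr1.
(* [L - (n + 1) * ln L] decreases on [[n, n + 1]], so [L = n] is the worst case. *)
have : L - n%:R <= n.+1%:R * (ln L - ln n%:R).
  rewrite -ln_div ?posrE; [|lra|lra].
  have /(ler_wpM2l (ler0n R n.+1)) := @ln_ge_1subV R (L / n%:R) ltac:(apply: divr_gt0; lra).
  apply: le_trans; rewrite invf_div -subr_ge0.
  (* After [ln t >= 1 - 1/t], both factors are nonnegative since [n <= L < n + 1]. *)
  rewrite (_ : _ - _ = (L - n%:R) * (n.+1%:R - L) / L); last by field; lra.
  by apply: divr_ge0; [apply: mulr_ge0|]; lra.
rewrite nE; lra.
Qed.

Lemma M_sifted r : (0 < r)%N ->
  r%:R * M R r = sifted_harmonic R (primes r) r / sieve_density R (primes r).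
Proof.
move=> r0; rewrite /M totient_sieve_density //.
have d0 := sieve_density_gt0 R _ (primes_prime r).
have -> : \sum_(1 <= l < r.+1 | coprime l r) (l%:R : R)^-1 = sifted_harmonic R (primes r) r.
  rewrite /sifted_harmonic big_nat_cond [RHS]big_nat_cond.
  apply: eq_bigl => l; apply: andb_id2l => /andP[l0 _].
  by rewrite sifted_primes.
have r0R : (0 : R) < r%:R by rewrite ltr0n.
by field; lra.
Qed.

Lemma M_lower r : (0 < r)%N -> ln r.+1%:R <= r%:R * M R r.
Proof.
move=> r0; rewrite M_sifted // ler_pdivlMr ?sieve_density_gt0 ?primes_prime //.
apply: le_trans (density_harmonic_le R _ r (primes_uniq r) (primes_prime r)).
rewrite mulrC; apply: ler_wpM2l; last exact: ln_succ_le_harmonic.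
by rewrite ltW // sieve_density_gt0 ?primes_prime.
Qed.

Lemma M_upper r : (1 < r)%N ->
  r%:R * M R r <= ln r%:R + log_weight R (primes r) + 3/2.
Proof.
move=> r1; have r0 : (0 < r)%N by exact: ltnW.
have d0 := sieve_density_gt0 R _ (primes_prime r).
rewrite M_sifted // ler_pdivrMr //.
set e := harmonic_sum R r - ln r%:R.
have e1 : e <= 1 by exact: harmonic_sub_ln_le1.
have he x : (0 < x <= r)%N -> 0 <= harmonic_sum R x - ln x%:R - e <= (2 * x%:R)^-1.
  move=> /andP[x0 xr]; have := harmonic_sub_ln_decr R x (r - x) x0.
  rewrite subnKC // => /andP[-> /= hi]; apply: le_trans hi _.
  by rewrite gerBl invr_ge0 mulr_ge0.
have rr : (0 < r <= r)%N by rewrite r0 /=.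
have dr : (\prod_(p <- primes r) p %| r)%N.
  apply: prod_dvdn_of_primes; rewrite ?primes_uniq ?primes_prime //.
  by apply/allP => p; rewrite mem_primes => /and3P[].
have := sieve_error R e r (primes r) he (primes_uniq r) (primes_prime r) r rr dr.
have -> : (primes r == [::]) = false.
  by apply/negbTE; rewrite primes_eq0 -leqNgt.
rewrite mul0r subr0 => /(le_trans (ler_norm _)).
(* Here [totient r = r * V] turns the sieve error into at most [V / 2]. *)
have pow : 2 ^+ size (primes r) / (4 * r%:R) <= sieve_density R (primes r) / 2.
  have r0R : (0 : R) < r%:R by rewrite ltr0n.
  rewrite ler_pdivrMr; last by lra.
  have : ((2 ^ size (primes r))%:R : R) <= (2 * totient r)%:R.
    by rewrite ler_nat pow2_size_primes_le.
  by rewrite natrX natrM totient_sieve_density //; lra.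
move=> /le_trans/(_ pow).
have := ler_wpM2l (ltW d0) e1.
move: (ln r%:R) (log_weight _ _) => a b; lra.
Qed.

Lemma M2 : 2 * M R 2 = 2.
Proof.
rewrite /M (_ : totient 2 = 1%N) // invr1 mul1r.
by rewrite big_mkcond /= big_nat_recr //= big_nat1 /= invr1 addr0 mulr1.
Qed.

End Bounds.

Theorem corollary1p3 (R : realType) (r : nat) (hr : (2 <= r)%N) :
  ln (r.+1%:R : R) <= r%:R * M R r /\
  r%:R * M R r <= ln (r%:R : R) + ln (ln (r%:R : R)) + ln (c1 R).
Proof.
split; first by apply: M_lower; exact: ltnW.
have c := ln_c1_ge R.
move: hr; rewrite leq_eqVlt => /predU1P[<-|r2].
  (* [ln (ln 2)] is negative; [ln t >= 1 - 1/t] bounds it below by -1. *)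
  rewrite M2; have l2 := ln2_ge R.
  have l0 : 0 < ln (2 : R) by lra.
  have : (ln (2 : R))^-1 <= 2.
    by rewrite -[leRHS]invrK lef_pV2 ?posrE //; lra.
  have := @ln_ge_1subV R (ln 2) l0; lra.
have := log_weight_primes_le_lnln R r r2; have := M_upper R r (ltnW r2); lra.
Qed.
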